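(* Let $f,g:\mathbb{N}\to\mathbb{N}$ be increasing functions such that $f(n)<g(n)\le 2^n$ for all $n\in\mathbb{N}$. Let $\mathcal{C}$ be a set of machines containing the Turing machines working in time $O(n+f(n))$. Then $\mathcal{C}/f\subsetneq\mathcal{C}/g$.
   Context: $\Sigma=\{0,1\}$. A class of languages $\mathcal{C}$ is identified with a (countable) class of (deterministic or probabilistic) machines deciding them (e.g. $\mathbf{P}$ with polynomial-time Turing machines, $\mathbf{BPP}$ with polynomial-time bounded-error probabilistic Turing machines). For $h:\mathbb{N}\to\mathbb{N}$, $L\in\mathcal{C}/h$ if there exist a language $L'\in\mathcal{C}$ and an advice function $\alpha:\mathbb{N}\to\Sigma^*$ with $|\alpha(n)|=h(n)$ for all $n$ such that for all $n$ and all $w\in\Sigma^n$: $w\in L\iff\langle w,\alpha(n)\rangle\in L'$ (equivalently, $L$ is decided by a machine of $\mathcal{C}$ which on inputs of length $n$ receives the advice string $\alpha(n)$).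
   Formalization: The set of machines C is also assumed closed under preprocessing by linear-time Turing machines whose output is no longer than their input; for an arbitrary set of machines the inclusion C/f ⊆ C/g can fail. *)

(* Defs.v *)
From mathcomp Require Import all_boot.
From mathcomp Require Export boolp classical_sets cardinality.

Set Implicit Arguments.
Unset Strict Implicit.
Unset Printing Implicit Defensive.

Local Open Scope classical_set_scope.

Definition word := seq bool.
Definition language := set word.

(* The tape alphabet: [None] is the blank, [Some (inl b)] the input bit [b],
   [Some (inr x)] an auxiliary symbol. *)
Definition symbol (aux : finType) := option (bool + aux)%type.

Inductive move := MoveLeft | Stay | MoveRight.

Record TM := MkTM {
  tm_ntapes : nat;  (* the machine has [tm_ntapes.+1] tapes *)
  tm_aux : finType;
  tm_state : finType;
  tm_start : tm_state;
  tm_halt : pred tm_state;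
  tm_accept : pred tm_state;
  tm_trans : tm_state -> {ffun 'I_tm_ntapes.+1 -> symbol tm_aux} ->
    tm_state * {ffun 'I_tm_ntapes.+1 -> symbol tm_aux * move}
}.

Record config (M : TM) := Config {
  cf_state : tm_state M;
  cf_head : 'I_(tm_ntapes M).+1 -> nat;
  cf_tape : 'I_(tm_ntapes M).+1 -> nat -> symbol (tm_aux M)
}.

(* Tapes are one-way infinite: a left move at cell 0 leaves the head
   at cell 0. *)
Definition move_head (m : move) (p : nat) : nat :=
  match m with MoveLeft => p.-1 | Stay => p | MoveRight => p.+1 end.

Definition word_tape (aux : finType) (x : word) (p : nat) : symbol aux :=
  omap inl (onth x p).

Definition tm_init (M : TM) (x : word) : config M :=
  Config (tm_start M) (fun=> 0)
    (fun i => if i == ord0 then word_tape (tm_aux M) x else fun=> None).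

Definition tm_step (M : TM) (c : config M) : config M :=
  if tm_halt (cf_state c) then c else
  let r := tm_trans (cf_state c) [ffun i => cf_tape c i (cf_head c i)] in
  Config r.1
    (fun i => move_head (r.2 i).2 (cf_head c i))
    (fun i p => if p == cf_head c i then (r.2 i).1 else cf_tape c i p).

Definition tm_run (M : TM) (x : word) (t : nat) : config M :=
  iter t (@tm_step M) (tm_init M x).

Definition halts_within (M : TM) (T : nat -> nat) : Prop :=
  forall x : word, tm_halt (cf_state (tm_run M x (T (size x)))).

Definition decides_within (M : TM) (L : language) (T : nat -> nat) : Prop :=
  halts_within M T /\
  forall x : word, L x <-> tm_accept (cf_state (tm_run M x (T (size x)))).

(* The output is the whole content of the last tape when the machine halts. *)
Definition computes_within (M : TM) (r : word -> word) (T : nat -> nat) : Prop :=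
  halts_within M T /\
  forall x p,
    cf_tape (tm_run M x (T (size x))) ord_max p = word_tape (tm_aux M) (r x) p.

Definition bigO (T t : nat -> nat) : Prop :=
  exists c N : nat, forall n, N <= n -> T n <= c * t n.

Definition TM_time (t : nat -> nat) : set language :=
  [set L | exists (M : TM) (T : nat -> nat), bigO T t /\ decides_within M L T].

Definition TM_computable_time (t : nat -> nat) (r : word -> word) : Prop :=
  exists (M : TM) (T : nat -> nat), bigO T t /\ computes_within M r T.

(* Machines of the class may be run after a linear-time Turing machine whose
   output is no longer than its input.  An arbitrary set of machines need not
   have this property, and the inclusion C/f `<=` C/g fails without it: for
   f = 0 and g = 1 add to linear time a single machine for
   [set pairing w [::] | w in K], with K not in linear time with 1 bit of
   advice.  The restriction on the length makes the property hold for
   [TM_time t] itself, for every nondecreasing [t] with [n <= t n]. *)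
Definition closed_under_preprocessing (C : set language) : Prop :=
  forall (L : language) (r : word -> word),
    C L -> TM_computable_time id r -> (forall x, size (r x) <= size x) ->
    C (r @^-1` L).

(* <w, a> = 1 w_1 1 w_2 ... 1 w_n 0 a *)
Definition pairing (w a : word) : word :=
  foldr (fun b s => true :: b :: s) (false :: a) w.

Definition with_advice (C : set language) (h : nat -> nat) : set language :=
  [set L | exists (L' : language) (alpha : nat -> word),
    [/\ C L', (forall n, size (alpha n) = h n) &
        forall (n : nat) (w : word), size w = n ->
          (L w <-> L' (pairing w (alpha n)))]].

(* Main.v *)
Require Import Defs.
From HB Require Import structures.
From mathcomp Require Import all_boot.
From mathcomp Require Import boolp classical_sets cardinality.
From mathcomp Require Import zify.

Set Implicit Arguments.
Unset Strict Implicit.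
Unset Printing Implicit Defensive.

Local Open Scope classical_set_scope.

(** Inclusion: pad the advice [a] to [a 1 0^k]; a linear-time machine strips the
    trailing [1 0^k] from [<w, a 1 0^k>], leaving [<w, a>].

    Strictness: let [V] be the language of the pairs [<w, a>] such that the bit
    of [a] at the position whose binary expansion is [w] is 1.  Since [g n] is
    at most [2 ^ n], distinct advice strings of length [g n] define distinct
    sets of words of length [n] through [V], so by pigeonhole one of these
    [2 ^ g n] sets differs from the at most [2 ^ f n] sets which the [n]-th
    language of [C] defines with advice of length [f n].  The language made of
    these sets is in [C/g] but not in [C/f].  [V] is decided in linear time by
    decrementing a binary counter, initially [w], along a scan of [a]: the cost
    of the carries is amortized by the number of zeros of the counter. *)

(** * Turing machine tapes as zippers *)

Section Streams.
Variable T : Type.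

Definition scons (x : T) (s : nat -> T) (p : nat) : T :=
  if p is p'.+1 then s p' else x.

Definition shift (s : nat -> T) (p : nat) : T := s p.+1.

(* [(l, r)]: [l] lists the cells to the left of the head, nearest first, and
   [r] the cells from the head on. *)
Definition zipper := (seq T * (nat -> T))%type.

(** A left move; the empty case is a head that stays at cell 0. *)
Definition focus (l : seq T) (r : nat -> T) : zipper :=
  if l is x :: l' then (l', scons x r) else ([::], r).

Definition zmove (x : T) (m : move) (z : zipper) : zipper :=
  match m with
  | MoveLeft => focus z.1 (scons x (shift z.2))
  | Stay => (z.1, scons x (shift z.2))
  | MoveRight => (x :: z.1, shift z.2)
  end.

(** Rewinds the head to the origin, so that the result is indexed by absolute cells. *)
Fixpoint ztape_rec (l : seq T) (r : nat -> T) : nat -> T :=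
  if l is x :: l' then ztape_rec l' (scons x r) else r.

Definition ztape (z : zipper) : nat -> T := ztape_rec z.1 z.2.

Lemma ztape_rec_right l r p : ztape_rec l r (size l + p) = r p.
Proof. by elim: l r p => //= x l IH r p; rewrite addSnnS IH. Qed.

Lemma ztape_rec_left l r r' p :
  p < size l -> ztape_rec l r p = ztape_rec l r' p.
Proof.
elim: l r r' p => //= x l IH r r' p; rewrite ltnS leq_eqVlt => /orP[/eqP->|lt_p].
  by rewrite -[size l]addn0 !ztape_rec_right.
exact: IH.
Qed.

Lemma ztape_head z : ztape z (size z.1) = z.2 0.
Proof. by rewrite /ztape -[size _]addn0 ztape_rec_right. Qed.

Lemma ztape_focus l r : ztape (focus l r) = ztape_rec l r.
Proof. by case: l. Qed.

Lemma ztape_write z x :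
  (fun p => if p == size z.1 then x else ztape z p)
  = ztape_rec z.1 (scons x (shift z.2)).
Proof.
apply/funext => p; rewrite /ztape; case: z => l r /=.
have [lt_p|le_p] := ltnP p (size l).
  by rewrite ltn_eqF // (@ztape_rec_left _ _ r).
rewrite -(subnKC le_p) !ztape_rec_right -[X in _ == X]addn0 eqn_add2l.
by case: (p - _).
Qed.

Lemma ztape_move z x m :
  (fun p => if p == size z.1 then x else ztape z p) = ztape (zmove x m z).
Proof. by rewrite ztape_write; case: m => //=; rewrite ztape_focus. Qed.

Lemma size_zmove z x m : move_head m (size z.1) = size (zmove x m z).1.
Proof. by case: m => //=; case: z => [[]]. Qed.

End Streams.

Definition blank (aux : finType) : nat -> symbol aux := fun=> None.

Lemma scons_blank aux : scons None (@blank aux) = @blank aux.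
Proof. by apply/funext => -[]. Qed.

Lemma word_tape_nil aux : word_tape aux [::] = @blank aux.
Proof. by apply/funext => -[]. Qed.

Lemma word_tape_cons aux b x :
  word_tape aux (b :: x) = scons (Some (inl b)) (word_tape aux x).
Proof. by apply/funext => -[]. Qed.

Definition bits (aux : finType) (u : word) : seq (symbol aux) :=
  map (fun b => Some (inl b)) u.

Lemma ztape_bits aux u s :
  ztape_rec (bits aux u) (word_tape aux s) = word_tape aux (catrev u s).
Proof. by elim: u s => //= b u IH s; rewrite -word_tape_cons IH. Qed.

(** * Runs from zipper configurations *)

Section Runs.
Variable M : TM.

Definition zconfig (q : tm_state M)
    (z : 'I_(tm_ntapes M).+1 -> zipper (symbol (tm_aux M))) : config M :=
  Config q (fun i => size (z i).1) (fun i => ztape (z i)).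

Lemma tm_step_zconfig q z : ~~ tm_halt q ->
  let t := tm_trans q [ffun i => (z i).2 0] in
  tm_step (zconfig q z) = zconfig t.1 (fun i => zmove (t.2 i).1 (t.2 i).2 (z i)).
Proof.
move=> /negbTE nq; rewrite /tm_step /= nq.
have -> : [ffun i => ztape (z i) (size (z i).1)] = [ffun i => (z i).2 0].
  by apply/ffunP => i; rewrite !ffunE ztape_head.
congr Config; apply/funext => i; first exact: size_zmove.
exact: ztape_move.
Qed.

(** Only an upper bound on the time: [tm_step] fixes halted configurations, so bounds can be rounded
    up freely. *)
Definition finishes (c : config M) (k : nat) (P : config M -> Prop) : Prop :=
  exists2 j, j <= k &
    let c' := iter j (@tm_step M) c in tm_halt (cf_state c') /\ P c'.

Lemma finishes_halt c k P : tm_halt (cf_state c) -> P c -> finishes c k P.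
Proof. by exists 0. Qed.

Lemma finishes_step c k P : finishes (tm_step c) k P -> finishes c k.+1 P.
Proof. by case=> j le_j; rewrite -iterSr => fin; exists j.+1. Qed.

Lemma finishes_leq c k k' P : k <= k' -> finishes c k P -> finishes c k' P.
Proof. by move=> le_k [j le_j ?]; exists j => //; apply: leq_trans le_k. Qed.

Lemma finishes_run x k P :
  finishes (tm_init M x) k P -> tm_halt (cf_state (tm_run M x k)) /\ P (tm_run M x k).
Proof.
case=> j le_j; rewrite /tm_run -(subnK le_j) iterD.
set c := iter j _ _ => -[hc Pc]; suff -> : iter (k - j) (@tm_step M) c = c by [].
by elim: (k - j) => //= i ->; rewrite /tm_step hc.
Qed.

End Runs.

(** * Stripping the padding *)

Fixpoint strip_rev (y : word) : word :=
  match y with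
  | [::] => [::]
  | true :: y' => y'
  | false :: y' => strip_rev y'
  end.

Definition strip (x : word) : word := rev (strip_rev (rev x)).

Lemma size_strip x : size (strip x) <= size x.
Proof.
rewrite /strip size_rev -(size_rev x).
by elim: (rev x) => // -[] y IH /=; [exact: leqnSn | exact: leqW].
Qed.

Lemma strip_pad x k : strip (x ++ true :: nseq k false) = x.
Proof.
have rev_nseq : rev (nseq k false) = nseq k false.
  by elim: k => // k IH; rewrite /= rev_cons IH; elim: k {IH} => //= k ->.
rewrite /strip rev_cat rev_cons rev_nseq -cats1 -catA /=.
by elim: k {rev_nseq} => [|k IH] //=; rewrite revK.
Qed.

(* [Some true]: move to the right end; [Some false]: erase leftwards. *)
Definition strip_delta (q : option bool) (a : symbol unit) :
    option bool * (symbol unit * move) :=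
  match q, a with
  | Some true, Some _ => (q, (a, MoveRight))
  | Some true, None => (Some false, (None, MoveLeft))
  | Some false, Some (inl false) => (q, (None, MoveLeft))
  | _, _ => (None, (None, Stay))
  end.

Definition strip_TM : TM :=
  @MkTM 0 unit (option bool) (Some true) (pred1 None) xpredT
    (fun q a => let t := strip_delta q (a ord0) in (t.1, [ffun=> t.2])).

Definition strip_config (q : option bool) z : config strip_TM :=
  @zconfig strip_TM q (fun=> z).

Lemma strip_step q z : q != None ->
  tm_step (strip_config q z) =
  let t := strip_delta q (z.2 0) in strip_config t.1 (zmove t.2.1 t.2.2 z).
Proof.
move=> nq; rewrite tm_step_zconfig //= ffunE /strip_config /zconfig /=.
by congr Config; apply/funext => i; rewrite !ffunE.
Qed.

(** Cells are erased on the way, so only blanks lie right of the head. If no 1 is met, the head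
    stops on cell 0, blank by then. *)
Lemma strip_backward y :
  finishes (strip_config (Some false) (focus (bits _ y) (@blank _))) (size y).+1
    (fun c => cf_tape c ord_max = word_tape unit (rev (strip_rev y))).
Proof.
elim: y => [|[] y IH] /=; apply: finishes_step; rewrite strip_step //=.
- by apply: finishes_halt; rewrite //= /ztape /= scons_blank word_tape_nil.
- apply: finishes_halt; rewrite //= /ztape /= scons_blank -word_tape_nil.
  exact: ztape_bits.
- by rewrite scons_blank.
Qed.

(** It takes [size x + 1] steps to reach the blank and turn back, then [size x + size y + 1] steps
    by [strip_backward]. *)
Lemma strip_forward x y :
  finishes (strip_config (Some true) (bits _ y, word_tape _ x))
    ((size x).*2 + size y).+2
    (fun c => cf_tape c ord_max = word_tape unit (rev (strip_rev (catrev x y)))).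
Proof.
elim: x y => [|b x IH] y.
  rewrite word_tape_nil; apply: finishes_step; rewrite strip_step //= scons_blank.
  exact: strip_backward.
apply: (@finishes_leq _ _ ((size x).*2 + (size y).+1).+3); first by rewrite /=; lia.
by apply: finishes_step; rewrite strip_step //=; apply: (IH (b :: y)).
Qed.

Lemma strip_computable : TM_computable_time id strip.
Proof.
exists strip_TM, (fun n => n.*2.+2); split; first by exists 4, 1 => n; lia.
have run x : finishes (tm_init strip_TM x) (size x).*2.+2
    (fun c => cf_tape c ord_max = word_tape unit (strip x)).
  have -> : tm_init strip_TM x = strip_config (Some true) ([::], word_tape _ x).
    by congr Config; apply/funext => i; rewrite ord1.
  by have := strip_forward x [::]; rewrite addn0.
by split=> [x | x p]; have [hx tx] := finishes_run (run x) => //; rewrite tx.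
Qed.

(** * Inclusion of the advice classes *)

Lemma pairing_cat w a b : pairing w (a ++ b) = pairing w a ++ b.
Proof. by elim: w => //= c w ->. Qed.

Lemma with_advice_leq (C : set language) (f g : nat -> nat) :
  closed_under_preprocessing C -> (forall n, f n < g n) ->
  with_advice C f `<=` with_advice C g.
Proof.
move=> C_closed fg L [L' [alpha [CL' size_alpha L_iff]]].
(* The 1 that opens the padding takes one bit, available since [f n < g n]. *)
exists (strip @^-1` L'), (fun n => alpha n ++ true :: nseq (g n - (f n).+1) false).
split; first exact: C_closed CL' strip_computable size_strip.
  by move=> n; rewrite size_cat /= size_nseq size_alpha; have := fg n; lia.
by move=> n w wn; rewrite (L_iff n w wn) /= pairing_cat strip_pad.
Qed.

(** * Looking up a bit at a binary position *)

(* Counters have their least significant bit first. *)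
Fixpoint decrement (u : word) : option word :=
  match u with
  | [::] => None
  | true :: u' => Some (false :: u')
  | false :: u' => omap (cons true) (decrement u')
  end.

Fixpoint lookup (u s : word) : bool :=
  if s is b :: s' then
    if decrement u is Some u' then lookup u' s' else b
  else false.

Fixpoint bin_val (u : word) : nat :=
  if u is b :: u' then b + (bin_val u').*2 else 0.

Lemma bin_val_decrement u :
  bin_val u = if decrement u is Some u' then (bin_val u').+1 else 0.
Proof.
elim: u => // -[] u IH //=; rewrite IH.
by case: (decrement u) => //= u'; lia.
Qed.

Lemma lookup_nth u s : lookup u s = nth false s (bin_val u).
Proof.
elim: s u => [|b s IH] u /=; first by rewrite nth_nil.
by rewrite bin_val_decrement; case: (decrement u).
Qed.

Lemma bin_val_surj n i : i < 2 ^ n -> exists2 u, size u = n & bin_val u = i.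
Proof.
elim: n i => [|n IH] i; first by case: i => // _; exists [::].
rewrite expnS => lt_i; have [|u su vu] := IH i./2; first by lia.
by exists (odd i :: u); rewrite /= ?su // vu odd_double_half.
Qed.

(** [u] accumulates the first component in reverse, so its last bit becomes the least significant
    one; hence the [rev w] below. *)
Fixpoint pair_lookup (u x : word) : bool :=
  match x with
  | true :: b :: x' => pair_lookup (b :: u) x'
  | false :: s => lookup u s
  | _ => false
  end.

Lemma pair_lookup_pairing u w a :
  pair_lookup u (pairing w a) = lookup (catrev w u) a.
Proof. by elim: w u => //= b w IH u. Qed.

(* [Flag] and [Bit] copy the first component of the input to the second tape,
   to the right of a marker, so that the least significant bit of the counter
   is next to the head.  [Dec] propagates the borrow, and [Ret] brings the head
   back and advances to the next bit of the second component. *)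
Variant lookup_state := Start | Flag | Bit | Dec | Ret | Accept | Reject.

(** Transfers a finite type structure, as [tm_state] requires. *)
Definition lookup_state_code (q : lookup_state) : 'I_7 :=
  match q with
  | Start => inord 0 | Flag => inord 1 | Bit => inord 2 | Dec => inord 3
  | Ret => inord 4 | Accept => inord 5 | Reject => inord 6
  end.

Definition lookup_state_decode (i : 'I_7) : lookup_state :=
  nth Start [:: Start; Flag; Bit; Dec; Ret; Accept; Reject] i.

Lemma lookup_state_codeK : cancel lookup_state_code lookup_state_decode.
Proof. by case; rewrite /lookup_state_decode /= inordK. Qed.

HB.instance Definition _ := Finite.copy lookup_state (can_type lookup_state_codeK).

(** * The lookup machine and its running time *)

Section LookupMachine.
Notation sym := (symbol unit).

Definition marker : sym := Some (inr tt).

Definition lookup_halt (q : lookup_state) : bool :=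
  match q with Accept | Reject => true | _ => false end.

Definition lookup_accept (q : lookup_state) : bool :=
  match q with Accept => true | _ => false end.

Definition lookup_delta (q : lookup_state) (a c : sym) :
    lookup_state * (sym * move) * (sym * move) :=
  match q, a, c with
  | Start, _, _ => (Flag, (a, Stay), (marker, MoveRight))
  | Flag, Some (inl true), _ => (Bit, (a, MoveRight), (c, Stay))
  | Flag, Some (inl false), _ => (Dec, (a, MoveRight), (c, MoveLeft))
  | Bit, Some (inl _), _ => (Flag, (a, MoveRight), (a, MoveRight))
  | Dec, Some _, Some (inl false) =>
      (Dec, (a, Stay), (Some (inl true), MoveLeft))
  | Dec, Some _, Some (inl true) =>
      (Ret, (a, Stay), (Some (inl false), MoveRight))
  | Dec, Some (inl true), _ => (Accept, (a, Stay), (c, Stay))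
  | Ret, _, Some _ => (Ret, (a, Stay), (c, MoveRight))
  | Ret, _, None => (Dec, (a, MoveRight), (c, MoveLeft))
  | _, _, _ => (Reject, (a, Stay), (c, Stay))
  end.

Definition lookup_TM : TM :=
  @MkTM 1 unit lookup_state Start lookup_halt lookup_accept
    (fun q a => let t := lookup_delta q (a ord0) (a ord_max) in
       (t.1.1, [ffun i => if i == ord0 then t.1.2 else t.2])).

Definition lookup_config (q : lookup_state) (z0 z1 : zipper sym) :
    config lookup_TM :=
  @zconfig lookup_TM q (fun i => if i == ord0 then z0 else z1).

Lemma lookup_step q z0 z1 : ~~ lookup_halt q ->
  tm_step (lookup_config q z0 z1) =
  let t := lookup_delta q (z0.2 0) (z1.2 0) in
  lookup_config t.1.1 (zmove t.1.2.1 t.1.2.2 z0) (zmove t.2.1 t.2.2 z1).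
Proof.
move=> nq; rewrite tm_step_zconfig //= !ffunE /= /lookup_config /zconfig.
by congr Config; apply/funext => i; rewrite ffunE; case: (i == ord0).
Qed.

Notation outcome b := (fun c : config lookup_TM => lookup_accept (cf_state c) = b).

Lemma scons_head_shift (r : nat -> sym) : scons (r 0) (shift r) = r.
Proof. by apply/funext => -[]. Qed.

(** A borrow that reaches the marker reveals a counter equal to zero. *)
Definition counter (u : word) : seq sym := bits _ u ++ [:: marker].

Definition zeros (u : word) : nat := count negb u.

(** The amortization: a borrow turns [index true u] zeros into ones and creates a single zero. *)
Lemma zeros_decrement u u' :
  decrement u = Some u' -> zeros u' + index true u = (zeros u).+1.
Proof.
elim: u u' => // -[] u IH u' /=; first by case=> <-; rewrite addn0.
case: (decrement u) IH => [v|] //= /(_ v erefl) IH [<-].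
by rewrite /zeros /= add0n add1n -IH addnS.
Qed.

(** The borrow goes left over [index true u] zeros, clears a 1 in one step, and [Ret] crosses the
    same cells back; [K] pays for the rest of the run. *)
Lemma dec_phase u u' l0 b r0 r K P :
  let z0 := (l0, scons (Some (inl b)) r0) in
  decrement u = Some u' ->
  finishes (lookup_config Ret z0 (counter u', r)) K P ->
  finishes (lookup_config Dec z0 (focus (counter u) r)) (K + (index true u).*2.+1) P.
Proof.
move=> z0; elim: u u' r K => // -[] u IH u' r K /=.
  case=> <- fin; rewrite addn1; apply: finishes_step; rewrite lookup_step //.
  by case: b @z0 {IH} fin.
case dec_u: (decrement u) => [v|] //= [<-] fin.
apply: (@finishes_leq _ _ (K.+1 + (index true u).*2.+1).+1); first by lia.
have {}IH : finishes
    (lookup_config Dec z0 (focus (counter u) (scons (Some (inl true)) r)))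
    (K.+1 + (index true u).*2.+1) P.
  by apply: (IH v) => //; apply: finishes_step; rewrite lookup_step.
by apply: finishes_step; rewrite lookup_step //=; case: b @z0 {fin} IH.
Qed.

(** All bits of [u] are 0, so the borrow runs to the marker, where the scanned bit is the answer. *)
Lemma dec_zero u l0 b r0 r : decrement u = None ->
  finishes
    (lookup_config Dec (l0, scons (Some (inl b)) r0) (focus (counter u) r))
    (zeros u).+1 (outcome b).
Proof.
elim: u r => [|[] u IH] r //=.
  move=> _; apply: finishes_step; rewrite lookup_step //=.
  by case: b; apply: finishes_halt.
case dec_u: (decrement u) => // _; apply: finishes_step.
by rewrite lookup_step //=; case: b IH; apply.
Qed.

(** With potential [2 * zeros u], a round of [2 * index true u + 2] steps has amortized cost 4. *)
Lemma lookup_loop s u l0 :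
  finishes
    (lookup_config Dec (l0, word_tape _ s) (focus (counter u) (@blank _)))
    ((size s).*2.*2 + (zeros u).*2).+1 (outcome (lookup u s)).
Proof.
elim: s u l0 => [|b s IH] u l0.
  by apply: finishes_step; rewrite lookup_step //=; apply: finishes_halt.
rewrite [lookup _ _]/= word_tape_cons; case dec_u: (decrement u) => [u'|]; last first.
  by apply: finishes_leq (dec_zero _ _ _ _ dec_u) => //=; lia.
have zeros_u' := zeros_decrement dec_u.
apply: (@finishes_leq _ _ (((size s).*2.*2 + (zeros u').*2).+2
    + (index true u).*2.+1)); first by rewrite [size (b :: s)]/=; lia.
apply: dec_phase dec_u _; apply: finishes_step.
by rewrite lookup_step //= scons_blank; apply: IH.
Qed.

Lemma lookup_flag n x u l0 : size x <= n ->
  finishes (lookup_config Flag (l0, word_tape _ x) (counter u, @blank _))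
    ((size x).*2.*2 + (zeros u).*2).+2 (outcome (pair_lookup u x)).
Proof.
(* Induction on a bound of the size, because a round consumes two symbols, a flag and a bit. *)
elim: n x u l0 => [|n IH] [|[] x] u l0 //= le_x;
  try by apply: finishes_step; rewrite lookup_step //=; apply: finishes_halt.
  apply: finishes_step; rewrite lookup_step //= scons_blank.
  case: x le_x => [|b x] le_x.
    by apply: finishes_step; rewrite lookup_step //=; apply: finishes_halt.
  (* Copying a bit takes two steps and adds at most 2 to the potential, within the budget of 8 for
     two symbols. *)
  apply: (@finishes_leq _ _ ((size x).*2.*2 + (zeros (b :: u)).*2).+3).
    by rewrite /zeros /=; case: (b); lia.
  by apply: finishes_step; rewrite lookup_step //=; apply: (IH x (b :: u)); apply: ltnW.
apply: (@finishes_leq _ _ ((size x).*2.*2 + (zeros u).*2).+2); first by lia.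
by apply: finishes_step; rewrite lookup_step //= scons_blank; apply: lookup_loop.
Qed.

Lemma pair_lookup_TM_time (t : nat -> nat) : (forall n, n <= t n) ->
  TM_time t [set x | pair_lookup [::] x].
Proof.
move=> le_t; exists lookup_TM, (fun n => n.*2.*2.+3); split.
  by exists 7, 1 => n; have := le_t n; lia.
have run x : finishes (tm_init lookup_TM x) (size x).*2.*2.+3
    (outcome (pair_lookup [::] x)).
  have -> : tm_init lookup_TM x =
      lookup_config Start ([::], word_tape _ x) ([::], @blank _).
    by congr Config; apply/funext => i; case: (i == ord0).
  apply: finishes_step; rewrite lookup_step //= scons_head_shift.
  by have := @lookup_flag (size x) x [::] [::] (leqnn _); rewrite addn0.
by split=> x; have [hx ax] := finishes_run (run x) => //=; rewrite ax.
Qed.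

End LookupMachine.

(** * Diagonalization *)

(** Since [m <= 2 ^ n], every position of the advice is the value of some word of length [n]. *)
Lemma lookup_word_inj n m (a b : word) : m <= 2 ^ n -> size a = m -> size b = m ->
  (forall w, size w = n -> lookup (rev w) a = lookup (rev w) b) -> a = b.
Proof.
move=> le_m sa sb eq_ab; apply: (@eq_from_nth _ false); first by rewrite sa.
rewrite sa => i lt_i; have [u su <-] := bin_val_surj (leq_trans lt_i le_m).
by rewrite -!lookup_nth -(revK u) eq_ab // size_rev.
Qed.

(** Otherwise choice sends each [b] to an [a] defining the same set through [K]. This map is
    injective by [lookup_word_inj], against [2 ^ k < 2 ^ m]. *)
Lemma lookup_escape (K : language) (n k m : nat) : k < m -> m <= 2 ^ n ->
  exists2 b : word, size b = m &
    forall a : word, size a = k ->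
      ~ forall w, size w = n -> (lookup (rev w) b <-> K (pairing w a)).
Proof.
move=> lt_km le_m; apply: contrapT => none.
have /choice[h hP] (b : m.-tuple bool) : exists a : k.-tuple bool,
    forall w, size w = n -> (lookup (rev w) b <-> K (pairing w a)).
  apply: contrapT => no_a; apply: none; exists b; first exact: size_tuple.
  by move=> a sa a_b; apply: no_a; exists (tcast sa (in_tuple a)); rewrite val_tcast.
have h_inj : injective h.
  move=> b c eq_h; apply/val_inj/(@lookup_word_inj n m); rewrite ?size_tuple // => w wn.
  by apply/idP/idP => /(hP _ _ wn) Kw; apply/(hP _ _ wn); move: Kw; rewrite eq_h.
by have := leq_card h h_inj; rewrite !card_tuple card_bool leq_exp2l // leqNgt lt_km.
Qed.

Theorem theorem7 (f g : nat -> nat) (C : set language)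
  (f_incr : forall m n : nat, m <= n -> f m <= f n)
  (g_incr : forall m n : nat, m <= n -> g m <= g n)
  (fg : forall n : nat, f n < g n /\ g n <= 2 ^ n)
  (C_countable : countable C)
  (C_TM : TM_time (fun n => n + f n) `<=` C)
  (C_closed : closed_under_preprocessing C) :
  with_advice C f `<` with_advice C g.
Proof.
split; first by apply: with_advice_leq => // n; case: (fg n).
have /countable_injP[idx idx_inj] := C_countable.
have /choice[beta betaP] n : exists b : word, size b = g n /\
    forall K, C K -> idx K = n -> forall a : word, size a = f n ->
      ~ forall w, size w = n -> (lookup (rev w) b <-> K (pairing w a)).
  have [lt_fg le_g] := fg n.
  have [[K [CK Kn]]|none] := EM (exists K, C K /\ idx K = n); last first.
    (* No language of [C] has index [n], so any word of length [g n] will do. *)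
    exists (nseq (g n) false); rewrite size_nseq; split=> // K CK Kn.
    by case: none; exists K.
  have [b sb b_esc] := lookup_escape K lt_fg le_g.
  exists b; split=> // K' CK' K'n.
  by have -> : K' = K by apply: idx_inj; rewrite ?inE // K'n.
pose L : language := [set w | lookup (rev w) (beta (size w))].
have Lg : with_advice C g L.
  exists [set x | pair_lookup [::] x], beta; split.
  - by apply/C_TM/pair_lookup_TM_time => n; apply: leq_addr.
  - by move=> n; case: (betaP n).
  - by move=> n w wn; rewrite /L /= wn pair_lookup_pairing.
move=> /(_ L Lg)[K [alpha [CK size_alpha L_iff]]].
(* At length [idx K], the advice [beta (idx K)] escapes every set that [K] defines with [f (idx K)]
   bits. *)
case: (betaP (idx K)) => _ /(_ K CK erefl _ (size_alpha _)); apply => w wn.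
by rewrite -(L_iff _ _ wn) /L /= wn.
Qed.
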